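(* Let $R^{(\mathrm{col})}$ denote the $q\times q$ matrix with all coefficients equal to $1$, except on the diagonal where they are equal to $0$. Then the number of properly $q$-colored $(n,m)$-graphs is equal to the number of $(n,m)$-$(R^{(\mathrm{col})},\vec1)$-graphs. When $\frac mn$ is in a compact interval of $\mathbb R_{>0}$, its asymptotics is $$\frac{n^{2m}}{2^m m!}\left(1+\frac{2}{q-1}\frac mn\right)^{-\frac{q-1}{2}}\left(1-\frac1q\right)^m q^n+o(1).$$ For properly $q$-colored simple graphs, the previous asymptotics is replaced by $$\frac{n^{2m}}{2^m m!}\left(1+\frac{2}{q-1}\frac mn\right)^{-\frac{q-1}{2}}\left(1-\frac1q\right)^m q^n\exp\left(\left(\frac mn\right)^2\frac{q}{q-1}\right)+o(1).$$
   Context: Graphs are labelled, with vertex set $\{1,\dots,n\}$; loops and multiple edges are allowed; a graph is simple if it has neither. An $(n,m)$-graph has $n$ vertices and $m$ edges. Asymptotics are for $n\to\infty$ with the number $q$ of colors fixed; $\vec 1$ is the all-ones vector of size $q$. For a graph $G$ with $n$ vertices and $m$ edges, $\mathrm{seqv}(G)$ is the number of sequences $(v_1,w_1,\dots,v_m,w_m)\in\{1,\dots,n\}^{2m}$ such that the multiset of unordered pairs $\overline{v_iw_i}$ is the edge multiset of $G$, and $\kappa(G)=\mathrm{seqv}(G)/(2^m m!)$ (which is $1$ when $G$ is simple). A properly $q$-colored graph is a graph in which each vertex has a color in $\{1,\dots,q\}$ and no edge links two vertices with the same color; the number of properly $q$-colored graphs in a family is the sum of the factors $\kappa(G)$ over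 the colored graphs of the family. For a symmetric $q\times q$ matrix $R$ with non-negative coefficients, an $(n,m)$-$(R,\vec1)$-graph is an $(n,m)$-graph in which each vertex $v$ is given a type $t(v)\in\{1,\dots,q\}$, with weight $\omega(G)=\kappa(G)\prod_{\overline{vw}}R_{t(v),t(w)}$ (product over edges, with multiplicity); their number is the sum of their weights.
   Formalization: The factor for simple graphs is corrected to exp(-(m/n)^2 q/(q-1)) (the printed plus sign is false: simple graphs are a subfamily); ''+o(1)'' is read as a relative error, a factor 1+o(1) uniform for m/n in the compact interval; the asymptotics are for q >= 2. *)

(* Defs.v *)
From HB Require Import structures.
From mathcomp Require Import all_boot all_order all_algebra.
From mathcomp Require Import all_classical all_reals all_analysis.

Set Implicit Arguments.
Unset Strict Implicit.
Unset Printing Implicit Defensive.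

Import Order.TTheory GRing.Theory Num.Theory.
Import numFieldNormedType.Exports.

Local Open Scope ring_scope.

(* A labelled (n, m)-graph, loops and multiple edges allowed, is given by its
   symmetric multiplicity function: f (v, w) is the number of edges linking v
   and w (for v = w, the number of loops at v). Each unordered pair is counted
   once, through its representative with v <= w. As there are m edges, the
   codomain 'I_m.+1 is no restriction; it makes the type of graphs finite. *)
Definition is_mgraph (n m : nat) (f : {ffun 'I_n * 'I_n -> 'I_m.+1}) : bool :=
  [forall v, forall w, f (v, w) == f (w, v)] &&
  (\sum_(p : 'I_n * 'I_n | p.1 <= p.2) f p == m)%N.

Record mgraph (n m : nat) := MGraph {
  mgraph_fun : {ffun 'I_n * 'I_n -> 'I_m.+1};
  mgraph_funP : is_mgraph mgraph_fun
}.

HB.instance Definition _ (n m : nat) := [isSub for @mgraph_fun n m].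
HB.instance Definition _ (n m : nat) := [Finite of mgraph n m by <:].

Definition mult (n m : nat) (G : mgraph n m) (v w : 'I_n) : nat :=
  mgraph_fun G (v, w).

Definition same_upair (n : nat) (e f : 'I_n * 'I_n) : bool :=
  (e == f) || (e == (f.2, f.1)).

Definition seqv (n m : nat) (G : mgraph n m) : nat :=
  #|[pred s : m.-tuple ('I_n * 'I_n) |
      [forall v, forall w,
         count (fun e => same_upair e (v, w)) s == mult G v w]]|.

Definition kappa (R : realType) (n m : nat) (G : mgraph n m) : R :=
  (seqv G)%:R / (2 ^ m * m`!)%:R.

Definition simple_graph (n m : nat) (G : mgraph n m) : bool :=
  [forall v, mult G v v == 0] && [forall v, forall w, (mult G v w <= 1)%N].

(* A loop links a vertex to itself, so a graph with a loop has no proper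
   coloring (take v = w). *)
Definition proper_coloring (n m q : nat) (G : mgraph n m)
    (c : {ffun 'I_n -> 'I_q}) : bool :=
  [forall v, forall w, (0 < mult G v w)%N ==> (c v != c w)].

Definition nb_colored (R : realType) (q n m : nat) : R :=
  \sum_(x : mgraph n m * {ffun 'I_n -> 'I_q} | proper_coloring x.1 x.2)
    kappa R x.1.

Definition nb_colored_simple (R : realType) (q n m : nat) : R :=
  \sum_(x : mgraph n m * {ffun 'I_n -> 'I_q} |
          simple_graph x.1 && proper_coloring x.1 x.2)
    kappa R x.1.

(* Meant for symmetric A, for which the choice of the representative v <= w of
   each unordered pair is irrelevant. *)
Definition typed_weight (R : realType) (q n m : nat) (A : 'M[R]_q)
    (G : mgraph n m) (t : {ffun 'I_n -> 'I_q}) : R :=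
  kappa R G *
  \prod_(p : 'I_n * 'I_n | (p.1 <= p.2)%N)
    A (t p.1) (t p.2) ^+ mult G p.1 p.2.

Definition nb_typed (R : realType) (q : nat) (A : 'M[R]_q) (n m : nat) : R :=
  \sum_(x : mgraph n m * {ffun 'I_n -> 'I_q}) typed_weight A x.1 x.2.

Definition Rcol (R : realType) (q : nat) : 'M[R]_q :=
  \matrix_(i, j) (if i == j then 0 else 1).

Definition colored_asymp (R : realType) (q n m : nat) : R :=
  n%:R ^+ (2 * m) / (2 ^ m * m`!)%:R
  * (1 + 2 / (q%:R - 1) * (m%:R / n%:R)) `^ (- ((q%:R - 1) / 2))
  * (1 - 1 / q%:R) ^+ m * q%:R ^+ n.

(* The exponent is negative: it accounts for the probability of having no
   multiple edge, and simple graphs are at most as many as all graphs. The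
   source prints it without the minus sign, for which the estimate is false. *)
Definition colored_simple_asymp (R : realType) (q n m : nat) : R :=
  colored_asymp R q n m
  * expR (- ((m%:R / n%:R) ^+ 2 * (q%:R / (q%:R - 1)))).

(* f n m = g n m (1 + o(1)) as n tends to infinity, uniformly for m / n in any
   compact interval of positive reals. *)
Definition equiv_on_compacts (R : realType) (f g : nat -> nat -> R) : Prop :=
  forall a b : R, 0 < a -> a <= b ->
  forall eps : R, 0 < eps ->
  \forall n \near \oo%classic, forall m : nat,
    a <= m%:R / n%:R <= b -> `|f n m - g n m| <= eps * `|g n m|.

(* Main.v *)
Require Import Defs.
From mathcomp Require Import all_boot all_order all_algebra.
From mathcomp Require Import all_classical all_reals all_analysis.
From mathcomp Require Import ring lra zify.

(** A sequence of [m] ordered pairs of vertices realizes exactly one graph, and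
    [kappa] counts these sequences up to the factor [2 ^ m * m`!]. Hence the
    number of colored graphs is [(2 ^ m * m`!)^-1 * \sum_c D c ^ m], where
    [D c] is the number of ordered pairs of vertices with different colors
    ([nb_coloredE]). Writing [V c] for the sum over the colors of the squared
    deviations of the class sizes from [n / q], one has
    [D c = n ^ 2 (1 - 1 / q) (1 - y c)] with
    [y c = q * V c / ((q - 1) n ^ 2)] ([nb_bichromaticE]). What remains is the
    mean of [(1 - y c) ^ m] over a uniform random coloring. As [y c] is of
    order [1 / n], this is the mean of [expR (- (m * y c))] up to [O(1 / m)].

    The number [n (q - 1) * y c] is Pearson's statistic of the coloring, whose
    limit law is chi-squared with [q - 1] degrees of freedom; with
    [s = m / (n (q - 1))], the mean is the Laplace transform of the statistic
    at [s], and the limit [(1 + 2 s) `^ (- ((q - 1) / 2))] is that of the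
    chi-squared law. Only these test functions matter, and the Gaussian
    averages of [expR (- (t * q * |x| ^ 2))] have the closed form [heat], so
    that Lindeberg's replacement argument needs no integral: the class sizes
    are the end point of a walk with [n] independent steps, and replacing one
    step by the heat flow costs [O(n ^ (- 3 / 2))] because the first two
    moments agree ([heat_step]). The total error is [O(n ^ (- 1 / 2))],
    uniformly for [m / n] bounded ([walk_heat]).

    For simple graphs, [D c ^ m] becomes the number
    [\prod_(i < m) (D c - 2 i)] of sequences without repeated unordered pair
    ([nb_colored_simpleE]). The quotient is close to
    [\prod_(i < m) expR (- (2 i / D c))], hence to [expR (- (m ^ 2 / D c))],
    and replacing [D c] by [n ^ 2 (1 - 1 / q)] costs [O(y c + 1 / n)], which is
    negligible in the mean since [y * expR (- (m * y)) <= 1 / m]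
    ([falling_prod_near], [mean_falling_imbalance]). *)

Set Implicit Arguments.
Unset Strict Implicit.
Unset Printing Implicit Defensive.

Import Order.TTheory GRing.Theory Num.Theory.
Import numFieldNormedType.Exports.

Local Open Scope classical_set_scope.
Local Open Scope ring_scope.

(** * Elementary exponential bounds *)

Section ExpBounds.
Variable R : realType.
Implicit Types x y z : R.

Lemma mul_expRN_le1 y : 0 <= y -> y * expR (- y) <= 1.
Proof.
move=> y0; rewrite expRN ler_pdivrMr ?expR_gt0// mul1r.
by have := expR_ge1Dx y; lra.
Qed.

Lemma sqr_mul_expRN_le4 y : 0 <= y -> y ^+ 2 * expR (- y) <= 4.
Proof.
move=> y0; have -> : - y = - (y / 2) + - (y / 2) by lra.
rewrite expRD; have := @mul_expRN_le1 (y / 2); set e := expR _ => h.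
have e0 : 0 <= y / 2 * e by rewrite mulr_ge0 ?expR_ge0//; lra.
have -> : y ^+ 2 * (e * e) = 4 * (y / 2 * e) ^+ 2 by field.
suff: (y / 2 * e) ^+ 2 <= 1 by lra.
by rewrite expr_le1// h//; lra.
Qed.

(** Multiplying [1 - z <= expR (- z)] by [expR z] gives
    [expR z - 1 <= z * expR z], which costs one power of [z] only. *)
Lemma expR_taylor1 z : 0 <= expR z - 1 - z <= z ^+ 2 * expR `|z|.
Proof.
have h1 := expR_ge1Dx z.
have h2 : expR z - 1 <= z * expR z.
  have := ler_wpM2r (expR_ge0 z) (expR_ge1Dx (- z)).
  by rewrite [leRHS]mulrC expRxMexpNx_1; lra.
apply/andP; split; first lra.
have [z0|z0] := leP 0 z.
  rewrite ger0_norm//; have := ler_wpM2l z0 h2; rewrite expr2; lra.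
have : z * (expR z - 1) <= z ^+ 2 by nra.
have : expR z - 1 - z <= z * (expR z - 1) by lra.
have : 1 <= expR `|z| by have := expR_ge1Dx `|z|; have := normr_ge0 z; lra.
by have := sqr_ge0 z; nra.
Qed.

(** The mean value theorem turns the first order bound into the second order
    one. *)
Lemma expR_taylor2 z : `|expR z - 1 - z - z ^+ 2 / 2| <= `|z| ^+ 3 * expR `|z|.
Proof.
pose g y := expR y - 1 - y - y ^+ 2 / 2.
have dg y : is_derive y 1 g (expR y - 1 - y).
  rewrite /g; apply: is_derive_eq.
  by rewrite /GRing.scale /=; field.
have cg a b : {within `[a, b], continuous g}.
  apply: derivable_within_continuous => y _; by have [] := dg y.
have g0 : g 0 = 0 by rewrite /g expR0; lra.
have bound c : `|c| <= `|z| -> `|(expR c - 1 - c) * z| <= `|z| ^+ 3 * expR `|z|.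
  move=> cz; rewrite normrM.
  have /andP[h1 h2] := expR_taylor1 c.
  rewrite (ger0_norm h1).
  have -> : `|z| ^+ 3 * expR `|z| = (`|z| ^+ 2 * expR `|z|) * `|z| by ring.
  apply: ler_wpM2r => //; apply: (le_trans h2).
  by rewrite -real_normK ?num_real// ler_pM// ?exprn_ge0 ?expR_ge0 ?lerXn2r ?ler_expR ?nnegrE.
have [z0|z0] := leP 0 z.
  have [c] := @MVT_segment R g (fun y => expR y - 1 - y) 0 z z0
    (fun y _ => dg y) (cg _ _).
  rewrite g0 !subr0 in_itv/= -/(g z) => /andP[c0 c1] ->.
  by apply: bound; rewrite !ger0_norm.
have [c] := @MVT_segment R g (fun y => expR y - 1 - y) z 0 (ltW z0)
  (fun y _ => dg y) (cg _ _).
rewrite g0 !sub0r in_itv/= -/(g z) => /andP[c0 c1].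
rewrite mulrN => /oppr_inj ->.
by apply: bound; rewrite (ler0_norm c1) (ler0_norm (ltW z0)) lerN2.
Qed.

(** The lower bound is [ln (1 + y) <= y] at the [y] for which [1 + y] is
    [(1 + 2 * x)^-1]. *)
Lemma ln1D2_bounds x : 0 <= x -> 2 * x - 4 * x ^+ 2 <= ln (1 + 2 * x) <= 2 * x.
Proof.
move=> x0; apply/andP; split; last by apply: le_ln1Dx; lra.
have p : 0 < 1 + 2 * x by lra.
have h : ln (1 + (- (2 * x / (1 + 2 * x)))) <= - (2 * x / (1 + 2 * x)).
  apply: le_ln1Dx; rewrite ltrN2 ltr_pdivrMr//; lra.
have e : 1 + (- (2 * x / (1 + 2 * x))) = (1 + 2 * x)^-1.
  by field; apply: lt0r_neq0.
move: h; rewrite e lnV ?posrE// => h.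
apply: (@le_trans _ _ (2 * x / (1 + 2 * x))); last by lra.
rewrite ler_pdivlMr//.
suff : 0 <= x ^+ 3 by nra.
exact: exprn_ge0.
Qed.

(** Since [1 - y <= expR (- y)] and
    [(1 - y ^+ 2) * expR (- y) <= 1 - y], Bernoulli's inequality bounds the
    difference by [m * y ^+ 2 * expR (- (m * y))], and
    [(m * y) ^+ 2 * expR (- (m * y)) <= 4]. *)
Lemma expRN_exprn1B (m : nat) y : (0 < m)%N -> 0 <= y <= 1 ->
  0 <= expR (- (m%:R * y)) - (1 - y) ^+ m <= 4 / m%:R.
Proof.
move=> m0 /andP[y0 y1].
have m0' : 0 < m%:R :> R by rewrite ltr0n.
have h1 : 1 - y <= expR (- y) by exact: expR_ge1Dx.
have h2 : (1 - y ^+ 2) * expR (- y) <= 1 - y.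
  have := ler_wpM2r (expR_ge0 (- y)) (expR_ge1Dx y).
  rewrite expRxMexpNx_1 => h.
  have : (1 - y) * ((1 + y) * expR (- y)) <= (1 - y) * 1.
    by rewrite ler_wpM2l//; lra.
  rewrite mulr1 => h'; apply: le_trans h'; rewrite le_eqVlt; apply/orP; left.
  by apply/eqP; ring.
have e : expR (- (m%:R * y)) = expR (- y) ^+ m by rewrite -mulrN expRM_natl.
have y2 : 0 <= 1 - y ^+ 2.
  by rewrite subr_ge0 expr_le1.
have bern (k : nat) : 1 - k%:R * y ^+ 2 <= (1 - y ^+ 2) ^+ k.
  elim: k => [|k IH]; first by rewrite expr0 mul0r subr0.
  rewrite (exprS (1 - y ^+ 2)); apply: le_trans (ler_wpM2l y2 IH).
  rewrite -natr1.
  have : 0 <= k%:R * y ^+ 2 * y ^+ 2 by rewrite !mulr_ge0 ?ler0n ?sqr_ge0.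
  by set u := y ^+ 2; set k' := k%:R; lra.
apply/andP; split.
  by rewrite subr_ge0 e lerXn2r ?nnegrE ?expR_ge0//; lra.
have h3 : (1 - m%:R * y ^+ 2) * expR (- (m%:R * y)) <= (1 - y) ^+ m.
  apply: (@le_trans _ _ (((1 - y ^+ 2) * expR (- y)) ^+ m)).
    by rewrite exprMn -e ler_wpM2r ?expR_ge0.
  by rewrite lerXn2r ?nnegrE ?mulr_ge0 ?expR_ge0//; lra.
have h4 : (m%:R * y) ^+ 2 * expR (- (m%:R * y)) <= 4.
  by apply: sqr_mul_expRN_le4; rewrite mulr_ge0// ler0n.
rewrite ler_pdivlMr//.
set E := expR (- (m%:R * y)) in h3 h4 *.
set P := (1 - y) ^+ m in h3 *.
have := ler_wpM2r (ltW m0') h3.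
have : (m%:R * y) ^+ 2 * E = m%:R * y ^+ 2 * E * m%:R by ring.
lra.
Qed.

End ExpBounds.

(** * Taylor remainders for one step of the walk *)

Section StepRemainders.
Variable R : realType.
Implicit Types (q d T e t V x : R).

Lemma poly_expRN_le a b c (Y : R) : 0 <= a -> 0 <= b -> 0 <= c -> 0 <= Y ->
  (a * Y ^+ 2 + b * Y + c) * expR (- Y) <= 4 * a + b + c.
Proof.
move=> a0 b0 c0 Y0.
have h1 := ler_wpM2l a0 (sqr_mul_expRN_le4 Y0).
have h2 := ler_wpM2l b0 (mul_expRN_le1 Y0).
have h3 : c * expR (- Y) <= c * 1.
  by rewrite ler_wpM2l// expR_le1 oppr_le0.
by rewrite !mulrDl -!mulrA; lra.
Qed.

(** The remainder for the walk: [z] is the exponent created by a step when the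
    walk is at [x] in the direction of the step and at squared distance [V] from
    the origin. Here [e] stands for [n ^ (- 1 / 2)]. The Gaussian factor
    [expR (- (q * t * V))] absorbs every power of [t * V], and [t * |x| <= T]
    holds because the walk has at most [n] steps. *)
Lemma taylor_remainder_cube q d T : 1 <= q -> 0 <= d -> 0 <= T ->
  exists2 C, 0 <= C & forall e t V x, 0 < e -> e <= 1 -> 0 <= t ->
    t <= T * e ^+ 2 -> x ^+ 2 <= V -> t * `|x| <= T ->
    let z := - (t * (2 * q * x + d)) in
    `|expR z - 1 - z - z ^+ 2 / 2| * expR (- (q * t * V)) <= C * e ^+ 3.
Proof.
move=> q1 d0 T0.
pose Z := 2 * q * T + d * T.
pose C1 := T * (4 * (16 * q) + (8 * q * (2 * q + d) * T + 4 * d ^+ 2 * T)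
  + 2 * d ^+ 2 * T ^+ 2 * (2 * q + d)).
have q0 : 0 <= q by lra.
have Z0 : 0 <= Z by rewrite /Z addr_ge0// !mulr_ge0//.
have C10 : 0 <= C1.
  by rewrite /C1 !(mulr_ge0, addr_ge0, exprn_ge0, sqr_ge0)//.
exists (expR Z * C1); first by rewrite mulr_ge0// expR_ge0.
move=> e t V x e0 e1 t0 tT xV txT /=; set z := - (t * (2 * q * x + d)).
have V0 : 0 <= V by apply: le_trans xV; exact: sqr_ge0.
set Y := q * t * V; have Y0 : 0 <= Y by rewrite /Y !mulr_ge0.
have e2 : e ^+ 2 <= 1 by rewrite expr_le1// ltW.
have tT1 : t <= T by apply: (le_trans tT); nra.
have nz : `|z| <= t * (2 * q * `|x| + d).
  rewrite /z normrN normrM (ger0_norm t0) ler_wpM2l//.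
  apply: (le_trans (ler_normD _ _)).
  by rewrite (ger0_norm d0) normrM (ger0_norm (_ : 0 <= 2 * q)) ?mulr_ge0.
have zZ : `|z| <= Z.
  apply: (le_trans nz); rewrite /Z.
  have h1 := ler_wpM2l (_ : 0 <= 2 * q) txT.
  have h2 := ler_wpM2l d0 tT1.
  have := h1 (mulr_ge0 (ler0n _ _) q0); lra.
have sz : `|z| ^+ 2 <= 8 * q * t * Y + 2 * d ^+ 2 * t ^+ 2.
  rewrite real_normK ?num_real// /z sqrrN exprMn.
  have -> : 8 * q * t * Y + 2 * d ^+ 2 * t ^+ 2 =
    t ^+ 2 * (8 * q ^+ 2 * V + 2 * d ^+ 2) by rewrite /Y; ring.
  rewrite ler_wpM2l ?sqr_ge0//.
  have h := ler_wpM2l (sqr_ge0 q) xV.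
  have := sqr_ge0 (2 * q * x - d).
  have -> : (2 * q * x - d) ^+ 2 =
    4 * (q ^+ 2 * x ^+ 2) - 4 * q * x * d + d ^+ 2 by ring.
  have -> : (2 * q * x + d) ^+ 2 =
    4 * (q ^+ 2 * x ^+ 2) + 4 * q * x * d + d ^+ 2 by ring.
  lra.
(* AM-GM on [e * `|x|] trades the odd power of [x] for even ones. *)
have ex : e * `|x| <= 1 + e ^+ 2 * V.
  have := ler_wpM2l (sqr_ge0 e) xV; rewrite -(real_normK (num_real x)).
  have := sqr_ge0 (e * `|x| - 1); have := sqr_ge0 (e * `|x|).
  rewrite !expr2; lra.
have ez : e * `|z| <= (2 * q + d) * t + 2 * e ^+ 2 * Y.
  apply: (@le_trans _ _ (e * (t * (2 * q * `|x| + d)))).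
    by rewrite ler_wpM2l// ltW.
  have -> : e * (t * (2 * q * `|x| + d)) = 2 * q * t * (e * `|x|) + d * t * e.
    by ring.
  have h1 := ler_wpM2l (_ : 0 <= 2 * q * t) ex.
  have h2 := ler_wpM2l (_ : 0 <= d * t) e1.
  rewrite /Y; have := h1 (mulr_ge0 (mulr_ge0 (ler0n _ _) q0) t0).
  have := h2 (mulr_ge0 d0 t0); lra.
have sz' : `|z| ^+ 2 <= e ^+ 2 * T * (8 * q * Y + 2 * d ^+ 2 * T).
  apply: (le_trans sz).
  have h1 := ler_wpM2r (mulr_ge0 (mulr_ge0 (ler0n R 8) q0) Y0) tT.
  have h2 : t * t <= T * e ^+ 2 * T by rewrite ler_pM.
  have h3 := ler_wpM2l (sqr_ge0 d) h2.
  rewrite [t ^+ 2]expr2; lra.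
have ez' : e * `|z| <= e ^+ 2 * ((2 * q + d) * T + 2 * Y).
  apply: (le_trans ez).
  have h := ler_wpM2l (addr_ge0 (mulr_ge0 (ler0n R 2) q0) d0) tT; lra.
have main : e * (`|z| ^+ 3 * expR (- Y)) <= e * (C1 * e ^+ 3).
  have -> : e * (`|z| ^+ 3 * expR (- Y)) =
    `|z| ^+ 2 * (e * `|z|) * expR (- Y) by ring.
  have h : `|z| ^+ 2 * (e * `|z|) <= (e ^+ 2 * T * (8 * q * Y + 2 * d ^+ 2 * T))
     * (e ^+ 2 * ((2 * q + d) * T + 2 * Y)).
    by rewrite ler_pM ?exprn_ge0// mulr_ge0// ltW.
  apply: (le_trans (ler_wpM2r (expR_ge0 _) h)).
  have -> : (e ^+ 2 * T * (8 * q * Y + 2 * d ^+ 2 * T))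
     * (e ^+ 2 * ((2 * q + d) * T + 2 * Y)) * expR (- Y) = e ^+ 4 * T *
     (((16 * q) * Y ^+ 2 + (8 * q * (2 * q + d) * T + 4 * d ^+ 2 * T) * Y
       + 2 * d ^+ 2 * T ^+ 2 * (2 * q + d)) * expR (- Y)) by ring.
  have -> : e * (C1 * e ^+ 3) = e ^+ 4 * T * (4 * (16 * q) +
    (8 * q * (2 * q + d) * T + 4 * d ^+ 2 * T)
     + 2 * d ^+ 2 * T ^+ 2 * (2 * q + d)) by rewrite /C1; ring.
  rewrite ler_wpM2l ?mulr_ge0 ?exprn_ge0 ?(ltW e0)//.
  by apply: poly_expRN_le => //; rewrite !(mulr_ge0, addr_ge0, exprn_ge0, sqr_ge0)//.
move: main; rewrite ler_pM2l// => main.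
apply: (@le_trans _ _ (expR Z * (`|z| ^+ 3 * expR (- Y)))).
  rewrite mulrA ler_wpM2r ?expR_ge0//.
  apply: (le_trans (expR_taylor2 z)); rewrite mulrC ler_wpM2r ?exprn_ge0//.
  by rewrite ler_expR.
by rewrite -[leRHS]mulrA ler_wpM2l// expR_ge0.
Qed.

(** The remainder for the heat flow: the left hand side of the difference is the
    mean of [1 + z + z ^+ 2 / 2] over the steps, for the [z] of the preceding
    lemma. *)
Lemma heat_remainder q d T : 1 <= q -> 0 <= d -> 0 <= T ->
  exists2 C, 0 <= C & forall e t V, 0 < e -> e <= 1 -> 0 <= t ->
    t <= T * e ^+ 2 -> 0 <= V -> t ^+ 2 * V <= q * T ^+ 2 ->
    let Y := q * t * V in
    `|1 - t * d + 2 * t * Y + t ^+ 2 * d ^+ 2 / 2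
      - expR (- (d / 2 * ln (1 + 2 * t)) + 2 * t * Y / (1 + 2 * t))|
    * expR (- Y) <= C * e ^+ 3.
Proof.
move=> q1 d0 T0; have q0 : 0 <= q by lra.
pose B := d * T + 2 * q ^+ 2 * T ^+ 2.
pose C1 := 4 * (8 * expR B) + 4 + (2 * d ^+ 2 * expR B + 2 * d + d ^+ 2).
have C10 : 0 <= C1 by rewrite /C1 !(mulr_ge0, addr_ge0, exprn_ge0, sqr_ge0, expR_ge0)//.
exists (T ^+ 2 * C1); first by rewrite mulr_ge0// sqr_ge0.
move=> e t V e0 e1 t0 tT V0 tV /=; set Y := q * t * V.
have Y0 : 0 <= Y by rewrite /Y !mulr_ge0.
have e2 : e ^+ 2 <= 1 by rewrite expr_le1// ltW.
have tT1 : t <= T by apply: (le_trans tT); nra.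
have p : 0 < 1 + 2 * t by lra.
set w := - (d / 2 * ln (1 + 2 * t)) + 2 * t * Y / (1 + 2 * t).
have /andP[l1 l2] := ln1D2_bounds t0.
set l := ln (1 + 2 * t) in w l1 l2 *.
have dl1 := ler_wpM2l d0 l1; have dl2 := ler_wpM2l d0 l2.
set v := 2 * t * Y / (1 + 2 * t) in w *.
have tY0 : 0 <= t * Y by rewrite mulr_ge0.
have v0 : 0 <= v by rewrite /v divr_ge0// ?(ltW p)// -mulrA mulr_ge0.
have v1 : v <= 2 * t * Y.
  rewrite /v ler_pdivrMr//; have := mulr_ge0 t0 tY0; nra.
have v2 : 2 * t * Y - 4 * t ^+ 2 * Y <= v.
  rewrite /v ler_pdivlMr//.
  have : 0 <= t ^+ 2 * (t * Y) by rewrite mulr_ge0// sqr_ge0.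
  by lra.
have l0 : 0 <= l by apply: ln_ge0; lra.
have dl0 : 0 <= d * l by rewrite mulr_ge0.
have td0 : 0 <= t * d by rewrite mulr_ge0.
have ttd0 : 0 <= d * t ^+ 2 by rewrite mulr_ge0// sqr_ge0.
have tt0 : 0 <= t ^+ 2 * Y by rewrite mulr_ge0// sqr_ge0.
have wlin : `|w - (- (t * d) + 2 * t * Y)| <= 2 * d * t ^+ 2 + 4 * t ^+ 2 * Y.
  by rewrite ler_norml /w; apply/andP; split; lra.
have nw : `|w| <= t * (d + 2 * Y).
  by rewrite ler_norml /w; apply/andP; split; lra.
have tYb : t * Y <= q ^+ 2 * T ^+ 2.
  have := ler_wpM2l q0 tV; rewrite /Y; lra.
have wB : `|w| <= B.
  apply: (le_trans nw); rewrite /B; have := ler_wpM2r d0 tT1; lra.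
have w2 : w ^+ 2 <= t ^+ 2 * (2 * d ^+ 2 + 8 * Y ^+ 2).
  rewrite -(real_normK (num_real w)).
  apply: (@le_trans _ _ ((t * (d + 2 * Y)) ^+ 2)).
    by rewrite lerXn2r ?nnegrE// mulr_ge0// addr_ge0// mulr_ge0.
  rewrite exprMn ler_wpM2l ?sqr_ge0//.
  have := sqr_ge0 (d - 2 * Y); rewrite !expr2; lra.
have /andP[tw0 tw1] := expR_taylor1 w.
have tw2 : w ^+ 2 * expR `|w| <= t ^+ 2 * (2 * d ^+ 2 + 8 * Y ^+ 2) * expR B.
  by rewrite ler_pM ?sqr_ge0 ?expR_ge0 ?ler_expR.
have tt1 : 0 <= t ^+ 2 * d ^+ 2 by rewrite mulr_ge0// sqr_ge0.
have bd : `|1 - t * d + 2 * t * Y + t ^+ 2 * d ^+ 2 / 2 - expR w|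
   <= t ^+ 2 * (8 * expR B * Y ^+ 2 + 4 * Y + (2 * d ^+ 2 * expR B + 2 * d + d ^+ 2)).
  move: wlin; rewrite !ler_norml => /andP[wl1 wl2].
  by apply/andP; split; lra.
apply: (le_trans (ler_wpM2r (expR_ge0 _) bd)).
rewrite -[leLHS]mulrA.
have := @poly_expRN_le (8 * expR B) 4 (2 * d ^+ 2 * expR B + 2 * d + d ^+ 2) Y.
rewrite !(mulr_ge0, addr_ge0, exprn_ge0, sqr_ge0, expR_ge0)// -/C1 => /(_ isT isT isT isT) h.
apply: (le_trans (ler_wpM2l (sqr_ge0 t) h)).
rewrite [leRHS]mulrAC ler_wpM2r//.
apply: (@le_trans _ _ ((T * e ^+ 2) ^+ 2)).
  by rewrite lerXn2r ?nnegrE// mulr_ge0// sqr_ge0.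
rewrite exprMn ler_wpM2l ?sqr_ge0// -exprM.
by rewrite ler_wiXn2l// ltW.
Qed.

End StepRemainders.

(** * Lindeberg replacement for the walk of the color classes *)

Section FiniteFunctions.

Definition fcons (T : Type) (n : nat) (j : T) (c : {ffun 'I_n -> T}) :
    {ffun 'I_n.+1 -> T} :=
  [ffun i => oapp c j (unlift ord0 i)].

Lemma fcons0 (T : Type) n (j : T) (c : {ffun 'I_n -> T}) : fcons j c ord0 = j.
Proof. by rewrite ffunE unlift_none. Qed.

Lemma fconsS (T : Type) n (j : T) (c : {ffun 'I_n -> T}) i :
  fcons j c (lift ord0 i) = c i.
Proof. by rewrite ffunE liftK. Qed.

Lemma sum_ffunS (V : nmodType) (T : finType) n (F : {ffun 'I_n.+1 -> T} -> V) :
  \sum_c F c = \sum_j \sum_(c : {ffun 'I_n -> T}) F (fcons j c).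
Proof.
rewrite pair_bigA /= (reindex (fun p : T * {ffun 'I_n -> T} => fcons p.1 p.2)) //=.
exists (fun c => (c ord0, [ffun i => c (lift ord0 i)])) => [[j c] _|c _] /=.
  rewrite fcons0; congr pair; apply/ffunP => i.
  by rewrite ffunE fconsS.
apply/ffunP => i; case: (unliftP ord0 i) => [k ->|->].
  by rewrite fconsS ffunE.
by rewrite fcons0.
Qed.

Lemma sum_ffun_nil (V : nmodType) (T : finType) (F : {ffun 'I_0 -> T} -> V) :
  \sum_c F c = F (ffun0 (card_ord 0)).
Proof.
by rewrite (big_pred1 (ffun0 (card_ord 0))) // => c; apply/esym/eqP/ffunP => -[].
Qed.

End FiniteFunctions.

Section Lindeberg.
Variables (R : realType) (q : nat).
Hypothesis q_gt0 : (0 < q)%N.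
Implicit Types (x : 'I_q -> R) (e t T : R).

Local Notation d := (q%:R - 1 : R).

Definition sqn x : R := \sum_i x i ^+ 2.

Definition step (j i : 'I_q) : R := (i == j)%:R - q%:R^-1.

(** The mean of [expR (- (t * q * sqn (x + g)))] for a centered Gaussian vector
    [g] with covariance [r / q] times the identity of the hyperplane of zero-sum
    vectors, of dimension [q - 1]: a solution of the heat equation in [(r, x)],
    in closed form. *)
Definition heat t (r : nat) x : R :=
  expR (- (d / 2 * ln (1 + 2 * (t * r%:R)))
        - t * q%:R * sqn x / (1 + 2 * (t * r%:R))).

Let q_neq0 : q%:R != 0 :> R.
Proof. by rewrite pnatr_eq0 -lt0n. Qed.

Let q_ge1 : 1 <= q%:R :> R.
Proof. by rewrite ler1n. Qed.

Lemma sum_const_ord (a : R) : \sum_(i < q) a = q%:R * a.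
Proof. by rewrite sumr_const card_ord mulr_natl. Qed.

Lemma sum_indicator_mul (j : 'I_q) x : \sum_i (i == j)%:R * x i = x j.
Proof.
rewrite (bigD1 j)//= eqxx mul1r big1 ?addr0// => i /negbTE ->.
by rewrite mul0r.
Qed.

Lemma sum_step j : \sum_i step j i = 0.
Proof.
rewrite /step sumrB sum_const_ord divff//.
have := sum_indicator_mul j (fun=> 1).
by under eq_bigr do rewrite mulr1; move=> ->; rewrite subrr.
Qed.

Lemma sqn_addstep x j : \sum_i x i = 0 ->
  sqn (fun i => x i + step j i) = sqn x + 2 * x j + d / q%:R.
Proof.
move=> x0; rewrite /sqn.
have -> : \sum_i (x i + step j i) ^+ 2 =
  \sum_i x i ^+ 2 + 2 * (\sum_i (i == j)%:R * x i) - 2 / q%:R * \sum_i x i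
  + ((1 - 2 / q%:R) * \sum_i ((i == j)%:R * 1) + \sum_(i < q) q%:R^-1 ^+ 2).
  rewrite !mulr_sumr -!big_split/= -sumrB -big_split/=; apply: eq_bigr => i _.
  by rewrite /step; case: (i == j) => /=; field.
rewrite !sum_indicator_mul x0 sum_const_ord; field.
exact: q_neq0.
Qed.

(** One step of the walk against one step of the heat flow: the two first
    moments of [step j] for uniform [j] are those of the centered Gaussian law
    with covariance [1 / q] times the identity of the hyperplane of zero-sum
    vectors. *)
Lemma heat_step T : 0 <= T ->
  exists2 C, 0 <= C & forall e t r x, 0 < e -> e <= 1 -> 0 <= t ->
    t <= T * e ^+ 2 -> \sum_i x i = 0 -> (forall i, t * `|x i| <= T) ->
    `|(\sum_j heat t r (fun i => x i + step j i)) / q%:R - heat t r.+1 x|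
      <= C * e ^+ 3.
Proof.
move=> T0; have d0 : 0 <= d by rewrite subr_ge0.
have [C1 C10 H1] := taylor_remainder_cube q_ge1 d0 T0.
have [C2 C20 H2] := heat_remainder q_ge1 d0 T0.
exists (C1 + C2); first exact: addr_ge0.
move=> e t r x e0 e1 t0 tT x0 xT.
set A := 1 + 2 * (t * r%:R).
have A1 : 1 <= A by have := mulr_ge0 t0 (ler0n R r); rewrite /A; lra.
have A0 : 0 < A by lra.
have Aneq0 : A != 0 by apply: lt0r_neq0.
(* [s] is the coefficient of [q * sqn x] in [heat t r x]. *)
pose s := t / A.
have s0 : 0 <= s by rewrite /s divr_ge0// ltW.
have st : s <= t by rewrite /s ler_pdivrMr//; nra.
have sT : s <= T * e ^+ 2 by apply: le_trans tT.
have sxT i : s * `|x i| <= T.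
  by apply: le_trans (xT i); rewrite ler_wpM2r.
set V := sqn x.
have V0 : 0 <= V by apply: sumr_ge0 => i _; exact: sqr_ge0.
have xV i : x i ^+ 2 <= V.
  rewrite /V /sqn (bigD1 i)//= lerDl sumr_ge0// => k _; exact: sqr_ge0.
have sV : s ^+ 2 * V <= q%:R * T ^+ 2.
  rewrite /V /sqn mulr_sumr.
  have -> : q%:R * T ^+ 2 = \sum_(i < q) T ^+ 2.
    by rewrite sum_const_ord.
  apply: ler_sum => i _; rewrite -exprMn -(real_normK (num_real _)).
  by rewrite lerXn2r ?nnegrE// normrM (ger0_norm s0).
pose z j := - (s * (2 * q%:R * x j + d)).
pose a := expR (- (d / 2 * ln A)).
set Y := q%:R * s * V.
pose w := - (d / 2 * ln (1 + 2 * s)) + 2 * s * Y / (1 + 2 * s).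
have p : 1 + 2 * s != 0 by apply: lt0r_neq0; lra.
have hz j : heat t r (fun i => x i + step j i) = a * expR (- Y) * expR (z j).
  rewrite /heat -/A sqn_addstep// -/V /a -!expRD; congr expR.
  by rewrite /Y /z /s; field; rewrite Aneq0 q_neq0.
have hw : heat t r.+1 x = a * expR (- Y) * expR w.
  have eA : 1 + 2 * (t * r.+1%:R) = A * (1 + 2 * s).
    by rewrite -natr1 /s; apply/eqP; rewrite /A; apply/eqP; field.
  rewrite /heat eA lnM ?posrE//; last by lra.
  rewrite -/V /a -!expRD; congr expR; rewrite /w /Y.
  have -> : t = s * A by rewrite /s divfK.
  by field; rewrite Aneq0 p.
pose g y : R := expR y - 1 - y - y ^+ 2 / 2.
have mean : (\sum_j (1 + z j + z j ^+ 2 / 2)) / q%:R =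
    1 - s * d + 2 * s * Y + s ^+ 2 * d ^+ 2 / 2.
  have -> : \sum_j (1 + z j + z j ^+ 2 / 2) =
      \sum_(j < q) (1 - s * d + s ^+ 2 * d ^+ 2 / 2)
      + (2 * s ^+ 2 * q%:R * d - 2 * s * q%:R) * (\sum_j x j)
      + 2 * s ^+ 2 * q%:R ^+ 2 * V.
    rewrite /V /sqn !mulr_sumr -!big_split/=; apply: eq_bigr => j _.
    by rewrite /z; field.
  rewrite x0 sum_const_ord /Y; field; exact: q_neq0.
(* The two expansions share their main terms by [mean]. *)
have split : (\sum_j heat t r (fun i => x i + step j i)) / q%:R - heat t r.+1 x
   = a * ((\sum_j (g (z j) * expR (- Y))) / q%:R
        + (1 - s * d + 2 * s * Y + s ^+ 2 * d ^+ 2 / 2 - expR w) * expR (- Y)).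
  rewrite hw -mean; under eq_bigr do rewrite hz.
  rewrite -mulr_sumr -mulr_suml.
  have -> : \sum_j expR (z j) =
      \sum_j g (z j) + \sum_j (1 + z j + z j ^+ 2 / 2).
    by rewrite -big_split; apply: eq_bigr => j _; rewrite /g /=; ring.
  by ring.
have a0 : 0 <= a by exact: expR_ge0.
have a1 : a <= 1.
  rewrite /a expR_le1 oppr_le0 mulr_ge0//; first by lra.
  exact: ln_ge0.
have b1 : `|(\sum_j (g (z j) * expR (- Y))) / q%:R| <= C1 * e ^+ 3.
  rewrite normrM normfV (ger0_norm (ler0n _ q)) ler_pdivrMr ?ltr0n//.
  apply: (le_trans (ler_norm_sum _ _ _)).
  have -> : C1 * e ^+ 3 * q%:R = \sum_(j < q) C1 * e ^+ 3.
    by rewrite sum_const_ord mulrC.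
  apply: ler_sum => j _; rewrite normrM (ger0_norm (expR_ge0 _)).
  exact: H1.
have b2 : `|(1 - s * d + 2 * s * Y + s ^+ 2 * d ^+ 2 / 2 - expR w)
            * expR (- Y)| <= C2 * e ^+ 3.
  rewrite normrM (ger0_norm (expR_ge0 _)); exact: H2.
rewrite split normrM (ger0_norm a0).
apply: (le_trans (ler_piMl (normr_ge0 _) a1)).
apply: (le_trans (ler_normD _ _)).
by rewrite [leRHS]mulrDl lerD.
Qed.

Definition walk n x (c : {ffun 'I_n -> 'I_q}) (i : 'I_q) : R :=
  x i + \sum_v step (c v) i.

Lemma walk_fcons n x j (c : {ffun 'I_n -> 'I_q}) :
  walk x (fcons j c) = walk (fun i => x i + step j i) c.
Proof.
apply/funext => i; rewrite /walk big_ord_recl fcons0 addrA.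
by congr (_ + _); apply: eq_bigr => v _; rewrite fconsS.
Qed.

Lemma step_norm_le1 j i : `|step j i| <= 1.
Proof.
have h0 : 0 <= (q%:R)^-1 :> R by rewrite invr_ge0.
have h1 : (q%:R)^-1 <= 1 :> R by rewrite invf_le1 ?ltr0n.
by rewrite /step ler_norml; case: (i == j) => /=; apply/andP; split; lra.
Qed.

(** Replacing the steps of the walk one at a time by the heat flow, the
    one-step errors add up. *)
Lemma walk_heat T : 0 <= T ->
  exists2 C, 0 <= C & forall n e t x, 0 < e -> e <= 1 -> 0 <= t ->
    t <= T * e ^+ 2 -> \sum_i x i = 0 ->
    (forall i, t * (`|x i| + n%:R) <= T) ->
    `|(\sum_(c : {ffun 'I_n -> 'I_q}) heat t 0 (walk x c)) / q%:R ^+ n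
       - heat t n x| <= n%:R * (C * e ^+ 3).
Proof.
move=> T0; have [C C0 H] := heat_step T0.
exists C => // n e t x e0 e1 t0 tT.
elim: n x => [|n IH] x x0 xT.
  rewrite sum_ffun_nil expr0 divr1 mul0r.
  rewrite (_ : walk _ _ = x) ?subrr ?normr0//.
  by apply/funext => i; rewrite /walk big_ord0 addr0.
rewrite sum_ffunS.
under eq_bigr do under eq_bigr do rewrite walk_fcons.
set S := fun j => \sum_(c : {ffun 'I_n -> 'I_q})
  heat t 0 (walk (fun i => x i + step j i) c).
pose u j := heat t n (fun i => x i + step j i).
have -> : (\sum_j S j) / q%:R ^+ n.+1 - heat t n.+1 x =
    (\sum_j (S j / q%:R ^+ n - u j)) / q%:R
    + ((\sum_j u j) / q%:R - heat t n.+1 x).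
  rewrite sumrB -mulr_suml exprS; field.
  by rewrite expf_neq0 q_neq0.
apply: (le_trans (ler_normD _ _)).
rewrite -natr1 mulrDl mul1r; apply: lerD; last first.
  apply: H => // i; apply: le_trans (xT i); rewrite ler_wpM2l// lerDl//.
rewrite normrM normfV (ger0_norm (ler0n _ q)) ler_pdivrMr ?ltr0n//.
apply: (le_trans (ler_norm_sum _ _ _)).
have -> : n%:R * (C * e ^+ 3) * q%:R = \sum_(j < q) n%:R * (C * e ^+ 3).
  by rewrite sum_const_ord mulrC.
apply: ler_sum => j _; apply: IH => [|i].
  by rewrite big_split/= x0 sum_step addr0.
apply: le_trans (xT i); rewrite ler_wpM2l//.
have := ler_normD (x i) (step j i); have := step_norm_le1 j i.
by rewrite -natr1; lra.
Qed.

End Lindeberg.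

(** * Sequences of pairs and the graphs they realize *)

Section CountTuples.
Variable T : finType.

Lemma sum_tupleS (V : nmodType) m (F : m.+1.-tuple T -> V) :
  \sum_s F s = \sum_(s : m.-tuple T) \sum_e F [tuple of e :: s].
Proof.
rewrite exchange_big pair_bigA /=.
rewrite (reindex (fun p : T * m.-tuple T => [tuple of p.1 :: p.2])) //=.
exists (fun s => (thead s, [tuple of behead s])) => [[e s] _|s _] /=.
  by congr pair; apply/val_inj.
by rewrite -tuple_eta.
Qed.

(** As validity passes to tails, a word is built one letter at a time and the
    numbers of choices for the successive letters multiply. *)
Lemma card_valid_tuples (valid : pred (seq T)) (f : nat -> nat) m :
  valid [::] -> (forall e s, valid (e :: s) -> valid s) ->
  (forall s, valid s -> #|[pred e | valid (e :: s)]| = f (size s)) ->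
  #|[pred s : m.-tuple T | valid s]| = (\prod_(i < m) f i)%N.
Proof.
move=> v0 vS ext; rewrite -sum1_card big_mkcond /=.
elim: m => [|m IH].
  rewrite big_ord0 (big_pred1 [tuple])/= ?inE ?v0// => s.
  by apply/esym/eqP; rewrite (tuple0 s); apply/val_inj.
rewrite (@sum_tupleS nat) big_ord_recr/= -IH big_distrl/=; apply: eq_bigr => s _.
rewrite -big_mkcond sum1_card inE/=; case: ifP => vs.
  by rewrite mul1n -[in RHS](size_tuple s) -ext//; apply: eq_card.
rewrite mul0n; apply: eq_card0 => e; rewrite !inE.
by apply/negP => /vS; rewrite vs.
Qed.

End CountTuples.

Section UnorderedPairs.
Variable n : nat.
Implicit Types (e f p : 'I_n * 'I_n) (s : seq ('I_n * 'I_n)).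

Definition swap e := (e.2, e.1).

Lemma swapK : involutive swap. Proof. by case. Qed.

Lemma same_upairE e f : same_upair e f = (f == e) || (f == swap e).
Proof.
rewrite /same_upair -/(swap f) eq_sym; congr orb.
by apply/eqP/eqP => ->; rewrite swapK.
Qed.

Lemma same_upair_refl e : same_upair e e.
Proof. by rewrite same_upairE eqxx. Qed.

Lemma same_upair_sym e f : same_upair e f = same_upair f e.
Proof.
rewrite !same_upairE eq_sym; congr orb.
by apply/eqP/eqP => ->; rewrite swapK.
Qed.

Lemma same_upair_swap e f : same_upair e (swap f) = same_upair e f.
Proof. by rewrite /same_upair /= orbC -!surjective_pairing. Qed.

Lemma same_upair_trans e f p : same_upair e f -> same_upair e p = same_upair f p.
Proof.
rewrite same_upairE => /orP[/eqP->//|/eqP->].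
by rewrite same_upair_sym -(same_upair_swap p e) same_upair_sym.
Qed.

Definition edge_count s v w := count (fun e => same_upair e (v, w)) s.

Lemma edge_count_sym s v w : edge_count s v w = edge_count s w v.
Proof.
by apply: eq_count => e; rewrite -(same_upair_swap e (v, w)).
Qed.

(** Each ordered pair has exactly one representative [p] with [p.1 <= p.2]. *)
Lemma sum_edge_count s :
  (\sum_(p : 'I_n * 'I_n | p.1 <= p.2) edge_count s p.1 p.2 = size s)%N.
Proof.
elim: s => [|e s IH]; first by rewrite big1.
rewrite /edge_count /= big_split/= -/(edge_count s) IH -add1n; congr addn.
wlog le_e : e / (e.1 <= e.2)%N.
  move=> H; case/orP: (leq_total e.1 e.2) => [|h]; first exact: H.
  rewrite -(H (swap e))//; apply: eq_bigr => p _.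
  by rewrite 2![same_upair _ (p.1, p.2)]same_upair_sym same_upair_swap.
rewrite (bigD1 e)//= -surjective_pairing same_upair_refl big1//= => p.
case/andP => le_p /negbTE ne_p; rewrite -surjective_pairing same_upairE ne_p/=.
case: eqP => // ep; move: le_p ne_p; rewrite ep /= => le_p.
suff -> : swap e = e by rewrite eqxx.
have h : e.1 = e.2 by apply/val_inj/eqP; rewrite eqn_leq le_e le_p.
by rewrite /swap -h {2}h -surjective_pairing.
Qed.

(** No multiple edge means that no unordered pair occurs twice. *)
Lemma edge_count_le1P s :
  reflect (forall v w, (edge_count s v w <= 1)%N)
          (pairwise (fun e f => ~~ same_upair e f) s).
Proof.
apply: (iffP idP) => [|H].
  elim: s => [|e s IH] //= /andP[He Hs] v w; rewrite /edge_count /=.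
  case Hp: (same_upair e (v, w)); last exact: IH.
  rewrite -/(edge_count s v w) (_ : edge_count s v w = 0%N)//.
  apply/eqP; rewrite -leqn0 leqNgt -has_count; apply/hasPn => f fs.
  by move/allP: He => /(_ f fs); rewrite same_upair_sym => /negP h; apply/negP => h';
     apply: h; rewrite (same_upair_trans _ h') same_upair_sym.
elim: s H => [|e s IH] //= H; apply/andP; split; last first.
  by apply: IH => v w; apply: leq_trans (H v w); rewrite /edge_count/= leq_addl.
have := H e.1 e.2; rewrite /edge_count/= -surjective_pairing same_upair_refl.
rewrite -[leqRHS]addn0 leq_add2l leqn0 => /eqP h; apply/allP => f fs.
rewrite same_upair_sym; apply/negP => hf.
by move/eqP: h; rewrite -leqn0 leqNgt -has_count => /hasP; apply; exists f.
Qed.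

End UnorderedPairs.

Section GraphOfSequence.
Variables n m : nat.
Implicit Types (s : m.-tuple ('I_n * 'I_n)) (G : mgraph n m).

Definition graph_fun s : {ffun 'I_n * 'I_n -> 'I_m.+1} :=
  [ffun p => inord (edge_count s p.1 p.2)].

Lemma graph_funE s v w : graph_fun s (v, w) = edge_count s v w :> nat.
Proof.
rewrite ffunE inordK// ltnS; apply: (leq_trans (count_size _ _)).
by rewrite size_tuple.
Qed.

Lemma graph_funP s : is_mgraph (graph_fun s).
Proof.
apply/andP; split.
  apply/forallP => v; apply/forallP => w; apply/eqP/val_inj.
  by rewrite /= !graph_funE edge_count_sym.
rewrite -[X in _ == X](size_tuple s) -sum_edge_count; apply/eqP.
by apply: eq_bigr => -[v w] _; rewrite graph_funE.
Qed.

Definition graph_of s : mgraph n m := MGraph (graph_funP s).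

Lemma mult_graph_of s v w : mult (graph_of s) v w = edge_count s v w.
Proof. exact: graph_funE. Qed.

Lemma mult_sym G v w : mult G v w = mult G w v.
Proof.
case: G => f /= fP; rewrite /mult /=.
by case/andP: fP => /forallP/(_ v)/forallP/(_ w)/eqP->.
Qed.

Lemma seqvE G : seqv G = #|[pred s | graph_of s == G]|.
Proof.
apply: eq_card => s; rewrite !inE; apply/forallP/eqP => [H|<- v].
  apply/val_inj/ffunP => -[v w]; apply/val_inj => /=.
  by rewrite graph_funE; move: H => /(_ v)/forallP/(_ w)/eqP.
by apply/forallP => w; rewrite mult_graph_of.
Qed.

(** Each sequence of pairs realizes one graph only, so that summing [seqv] is
    counting sequences. *)
Lemma sum_seqv (P : pred (mgraph n m)) :
  (\sum_(G | P G) seqv G = #|[pred s | P (graph_of s)]|)%N.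
Proof.
rewrite -sum1_card (partition_big graph_of P)//=; apply: eq_bigr => G PG.
rewrite seqvE -sum1_card; apply: eq_bigl => s; rewrite !inE.
by case: eqP => [->|]; rewrite ?PG ?andbF.
Qed.

End GraphOfSequence.

Section Colorings.
Variables n q : nat.
Implicit Types c : {ffun 'I_n -> 'I_q}.

Definition bichromatic c : pred ('I_n * 'I_n) := fun e => c e.1 != c e.2.

Lemma bichromatic_upair c e f : same_upair e f ->
  bichromatic c e = bichromatic c f.
Proof.
by rewrite same_upairE => /orP[/eqP->//|/eqP->]; rewrite /bichromatic eq_sym.
Qed.

Lemma proper_graph_of m c (s : m.-tuple ('I_n * 'I_n)) :
  proper_coloring (graph_of s) c = all (bichromatic c) s.
Proof.
apply/forallP/allP => [H e es|H v].
  have := H e.1 => /forallP/(_ e.2)/implyP; apply.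
  rewrite mult_graph_of -has_count; apply/hasP; exists e => //.
  by rewrite -surjective_pairing same_upair_refl.
apply/forallP => w; apply/implyP; rewrite mult_graph_of -has_count.
by case/hasP => e /H eb h; rewrite -[_ != _]/(bichromatic c (v, w))
  -(bichromatic_upair c h).
Qed.

(** A proper coloring already excludes loops. *)
Lemma simple_proper_graph_of m c (s : m.-tuple ('I_n * 'I_n)) :
  simple_graph (graph_of s) && proper_coloring (graph_of s) c =
  all (bichromatic c) s && pairwise (fun e f => ~~ same_upair e f) s.
Proof.
rewrite proper_graph_of andbC; case: (boolP (all _ s)) => //= /allP sb.
apply/andP/edge_count_le1P => [[_ /forallP H] v w|H].
  by rewrite -mult_graph_of; move: (H v) => /forallP.
split; apply/forallP => v; last first.
  by apply/forallP => w; rewrite mult_graph_of.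
rewrite mult_graph_of -leqn0 leqNgt -has_count; apply/hasPn => e /sb eb.
by apply/negP => /(bichromatic_upair c); rewrite eb /bichromatic eqxx.
Qed.

Definition nb_bichromatic c := #|bichromatic c|.

Lemma card_bichromatic_tuples m c :
  #|[pred s : m.-tuple ('I_n * 'I_n) | all (bichromatic c) s]| =
  (nb_bichromatic c ^ m)%N.
Proof.
rewrite (@card_valid_tuples _ (all (bichromatic c)) (fun=> nb_bichromatic c))//=.
- by rewrite prod_nat_const card_ord.
- by move=> e s /andP[].
- by move=> s vs; apply: eq_card => e; rewrite !inE /= vs andbT.
Qed.

(** The pairs of a repetition-free sequence exclude two ordered pairs each,
    the pair itself and its reversal, as a bichromatic pair is not a loop. *)
Lemma card_simple_bichromatic_tuples m c :
  #|[pred s : m.-tuple ('I_n * 'I_n) |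
      all (bichromatic c) s && pairwise (fun e f => ~~ same_upair e f) s]| =
  (\prod_(i < m) (nb_bichromatic c - 2 * i))%N.
Proof.
pose valid s := all (bichromatic c) s && pairwise (fun e f => ~~ same_upair e f) s.
rewrite (@card_valid_tuples _ valid (fun i => nb_bichromatic c - 2 * i)%N)//.
  by rewrite /valid => e s /andP[/= /andP[_ ->] /andP[_ ->]].
move=> s vs.
pose A s := [set e | bichromatic c e & all (fun f => ~~ same_upair e f) s].
have -> : #|[pred e | valid (e :: s)]| = #|A s|.
  apply: eq_card => e; rewrite !inE /valid /=; move: vs => /andP[-> ->].
  by rewrite !andbT.
elim: s vs => [|x s IH] /=.
  by move=> _; rewrite muln0 subn0; apply: eq_card => e; rewrite !inE andbT.
move=> /andP[/= /andP[xb sb] /andP[xs ps]].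
have /IH IH' : valid s by rewrite /valid sb.
have -> : A (x :: s) = (A s :\ x) :\ swap x.
  apply/setP => e; rewrite !inE /= same_upair_sym same_upairE negb_or.
  by case: (e == x); case: (e == swap x); rewrite ?andbF.
have xA : x \in A s by rewrite inE xb.
have xx : swap x != x.
  apply/eqP => h; move: xb; rewrite /bichromatic -{1}h/= eqxx//.
have sA : swap x \in A s :\ x.
  rewrite !inE xx -(bichromatic_upair c (e := x)) ?xb/=; last first.
    by rewrite same_upair_swap same_upair_refl.
  apply: sub_all xs => f; apply: contra => h.
  by rewrite same_upair_sym -(same_upair_swap f x) same_upair_sym.
have := cardsD1 x (A s); rewrite xA => h1.
have := cardsD1 (swap x) (A s :\ x); rewrite sA => h2.
by move: IH'; rewrite h1 h2 /= !add1n => h; rewrite mulnS addnC subnDA -h subn2.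
Qed.

End Colorings.

(** * Exact formulas for the weighted counts *)

Section ExactCounts.
Variables (R : realType) (q n m : nat).
Implicit Types c : {ffun 'I_n -> 'I_q}.

Lemma prod_Rcol (G : mgraph n m) c :
  \prod_(p : 'I_n * 'I_n | (p.1 <= p.2)%N)
    (Rcol R q) (c p.1) (c p.2) ^+ mult G p.1 p.2 = (proper_coloring G c)%:R.
Proof.
have [/forallP H|] := boolP (proper_coloring G c).
  apply: big1 => -[v w] /= _; rewrite mxE.
  have /forallP/(_ w)/implyP := H v.
  by case: (mult G v w) => [|k]; rewrite ?expr0// => /(_ isT)/negbTE ->; rewrite expr1n.
case/forallPn => v /forallPn[w]; rewrite negb_imply negbK => /andP[G0 cvw].
wlog vw : v w G0 cvw / (v <= w)%N.
  move=> H; case/orP: (leq_total v w) => h; first exact: (H v w).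
  by apply: (H w v); [rewrite mult_sym | rewrite eq_sym | exact: h].
apply/eqP/prodf_eq0; exists (v, w) => //=.
by rewrite mxE cvw expr0n -leqn0 leqNgt G0.
Qed.

Lemma nb_colored_typed : nb_colored R q n m = nb_typed (Rcol R q) n m.
Proof.
rewrite /nb_colored big_mkcond; apply: eq_bigr => -[G c] _ /=.
by rewrite /typed_weight prod_Rcol; case: ifP => _; rewrite ?mulr1 ?mulr0.
Qed.

Lemma sum_kappa (P : mgraph n m -> {ffun 'I_n -> 'I_q} -> bool) :
  \sum_(x : mgraph n m * {ffun 'I_n -> 'I_q} | P x.1 x.2) kappa R x.1 =
  (\sum_c #|[pred s | P (graph_of s) c]|%:R) / (2 ^ m * m`!)%:R.
Proof.
rewrite big_mkcond -(pair_bigA _ (fun G c => if P G c then kappa R G else 0))/=.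
rewrite exchange_big mulr_suml; apply: eq_bigr => c _ /=.
by rewrite -big_mkcond -mulr_suml -natr_sum sum_seqv.
Qed.

Lemma nb_coloredE : nb_colored R q n m =
  (\sum_(c : {ffun 'I_n -> 'I_q}) (nb_bichromatic c)%:R ^+ m) / (2 ^ m * m`!)%:R.
Proof.
rewrite /nb_colored (sum_kappa (fun G c => proper_coloring G c)).
congr (_ / _); apply: eq_bigr => c _; rewrite -natrX -card_bichromatic_tuples.
by congr _%:R; apply: eq_card => s; rewrite !inE proper_graph_of.
Qed.

Lemma nb_colored_simpleE : nb_colored_simple R q n m =
  (\sum_(c : {ffun 'I_n -> 'I_q}) (\prod_(i < m) (nb_bichromatic c - 2 * i))%N%:R) / (2 ^ m * m`!)%:R.
Proof.
rewrite /nb_colored_simple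
  (sum_kappa (fun G c => simple_graph G && proper_coloring G c)).
congr (_ / _); apply: eq_bigr => c _; rewrite -card_simple_bichromatic_tuples.
by congr _%:R; apply: eq_card => s; rewrite !inE simple_proper_graph_of.
Qed.

(** The monochromatic ordered pairs number [\sum_i N i ^+ 2], for [N i] the size
    of the color class [i]; centering [N] at [n / q] subtracts
    [n ^+ 2 / q]. *)
Lemma nb_bichromatic_sqn c : (0 < q)%N ->
  (nb_bichromatic c)%:R =
  n%:R ^+ 2 * (1 - 1 / q%:R) - sqn (walk (fun=> 0 : R) c).
Proof.
move=> q0; have q_neq0 : q%:R != 0 :> R by rewrite pnatr_eq0 -lt0n.
pose N i : R := \sum_v (i == c v)%:R.
have N1 : \sum_i N i = n%:R.
  rewrite exchange_big /=.
  transitivity (\sum_(v < n) (1 : R)); last by rewrite sumr_const card_ord.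
  apply: eq_bigr => v _; rewrite -[RHS](sum_indicator_mul (c v) (fun=> 1 : R)).
  by apply: eq_bigr => i _; rewrite mulr1.
have N2 : \sum_i N i ^+ 2 = \sum_v \sum_w (c v == c w)%:R.
  under eq_bigr => i _.
    rewrite expr2 /N mulr_suml; under eq_bigr => v _ do rewrite mulr_sumr.
    over.
  rewrite exchange_big; apply: eq_bigr => v _; rewrite exchange_big.
  by apply: eq_bigr => w _; exact: (sum_indicator_mul (c v) (fun i => (i == c w)%:R)).
have W i : walk (fun=> 0 : R) c i = N i - n%:R / q%:R.
  by rewrite /walk /step add0r sumrB sum_const_ord.
have -> : sqn (walk (fun=> 0 : R) c) = \sum_i N i ^+ 2 - n%:R ^+ 2 / q%:R.
  rewrite /sqn; under eq_bigr do rewrite W.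
  have -> : \sum_i (N i - n%:R / q%:R) ^+ 2 =
     \sum_i N i ^+ 2 - 2 * n%:R / q%:R * (\sum_i N i)
     + \sum_(i < q) (n%:R / q%:R) ^+ 2.
    by rewrite mulr_sumr -sumrB -big_split; apply: eq_bigr => i _ /=; ring.
  by rewrite N1 sum_const_ord; field.
have -> : (nb_bichromatic c)%:R = \sum_v \sum_w (1 - (c v == c w)%:R) :> R.
  rewrite pair_bigA /nb_bichromatic -sum1_card natr_sum big_mkcond.
  apply: eq_bigr => -[v w] _; rewrite unfold_in /bichromatic /=.
  by case: (c v == c w); rewrite ?subrr ?subr0.
rewrite N2; under eq_bigr do rewrite sumrB sum_const_ord mulr1.
rewrite sumrB sum_const_ord; ring.
Qed.

End ExactCounts.

(** * Falling products *)

Section FallingProduct.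
Variable R : realType.
Implicit Types x y u v : R.

Lemma expRN_lipschitz u v : 0 <= u -> 0 <= v ->
  `|expR (- u) - expR (- v)| <= `|u - v|.
Proof.
wlog uv : u v / u <= v.
  move=> H u0 v0; case/orP: (le_total u v) => h; first exact: H.
  by rewrite distrC [leRHS]distrC; exact: H.
move=> u0 v0; rewrite ger0_norm ?subr_ge0 ?ler_expR ?lerN2//.
rewrite distrC ger0_norm ?subr_ge0//.
have -> : expR (- u) - expR (- v) = expR (- u) * (1 - expR (- (v - u))).
  by rewrite mulrBr mulr1 -expRD; congr (_ - expR _); ring.
have h1 := expR_ge1Dx (- (v - u)).
have h2 : expR (- u) <= 1 by rewrite expR_le1; lra.
have h3 : expR (- (v - u)) <= 1 by rewrite expR_le1; lra.
by apply: le_trans (ler_piMl _ h2) _; lra.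
Qed.

(** Telescoping in the unit interval. *)
Lemma norm_prodB_le k (a b : nat -> R) :
  (forall i, 0 <= a i <= 1) -> (forall i, 0 <= b i <= 1) ->
  `|\prod_(i < k) a i - \prod_(i < k) b i| <= \sum_(i < k) `|a i - b i|.
Proof.
move=> a01 b01.
have p01 j : 0 <= \prod_(i < j) a i <= 1.
  apply/andP; split; first by apply: prodr_ge0 => i _; case/andP: (a01 i).
  by apply: prodr_ile1 => i _; exact: a01.
elim: k => [|k IH]; first by rewrite !big_ord0 subrr normr0.
rewrite !big_ord_recr/=.
set A := \prod_(i < k) a i in IH *; set B := \prod_(i < k) b i in IH *.
have -> : A * a k - B * b k = (A - B) * b k + A * (a k - b k) by ring.
apply: (le_trans (ler_normD _ _)); rewrite !normrM.
have /andP[A0 A1] := p01 k; have /andP[b0 b1] := b01 k.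
rewrite (ger0_norm A0) (ger0_norm b0); apply: lerD.
  by apply: le_trans IH; rewrite ler_piMr.
by rewrite ler_piMl.
Qed.

Lemma sum_double_ord k : \sum_(i < k) (2 * i)%:R = k%:R ^+ 2 - k%:R :> R.
Proof.
elim: k => [|k IH]; first by rewrite big_ord0 expr0n subr0.
by rewrite big_ord_recr/= IH -natr1 natrM; ring.
Qed.

(** The falling product over [D ^ m] is, up to lower order terms,
    [\prod_i (1 - 2 i / D)], hence [expR (- (m ^ 2 / D))]. *)
Lemma falling_prod_expR (D m : nat) : (0 < D)%N ->
  `|(\prod_(i < m) (D - 2 * i))%N%:R
      - D%:R ^+ m * expR (- ((m%:R ^+ 2 - m%:R) / D%:R))|
  <= D%:R ^+ m * (4 * m%:R ^+ 3 / D%:R ^+ 2) :> R.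
Proof.
move=> D0; have Dp : 0 < D%:R :> R by rewrite ltr0n.
have Dn : D%:R != 0 :> R by apply: lt0r_neq0.
pose a i : R := (D - 2 * i)%N%:R / D%:R.
pose b i : R := expR (- ((2 * i)%:R / D%:R)).
have x0 i : 0 <= (2 * i)%:R / D%:R :> R by rewrite divr_ge0.
have a01 i : 0 <= a i <= 1.
  by rewrite /a divr_ge0//= ler_pdivrMr// mul1r ler_nat leq_subr.
have b01 i : 0 <= b i <= 1 by rewrite /b expR_ge0/= expR_le1 oppr_le0.
have ab i : `|a i - b i| <= ((2 * i)%:R / D%:R) ^+ 2.
  have h1 := expR_ge1Dx (- ((2 * i)%:R / D%:R : R)).
  have h2 := expR_ge1Dx ((2 * i)%:R / D%:R : R).
  have h3 := expRxMexpNx_1 ((2 * i)%:R / D%:R : R).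
  have h4 : 1 - (2 * i)%:R / D%:R <= a i.
    have -> : 1 - (2 * i)%:R / D%:R = (D%:R - (2 * i)%:R) / D%:R :> R.
      by rewrite mulrBl divff.
    rewrite /a ler_wpM2r ?invr_ge0 ?(ltW Dp)//.
    rewrite lerBlDr -natrD ler_nat; lia.
  have h5 : a i <= b i.
    case: (leqP (2 * i) D) => h; last first.
      rewrite /a (_ : (D - 2 * i)%N = 0%N) ?mul0r ?expR_ge0//.
      by apply/eqP; rewrite subn_eq0 ltnW.
    by rewrite /a natrB// mulrBl divff.
  move: h1 h2 h3 h5 h4; rewrite /b.
  have := x0 i; set x := _ / D%:R; move: (a i) => ai.
  have := expR_ge0 (- x); set y := expR (- x); set z := expR x.
  move=> y0 hx h1 h2 h3 h5 h4; rewrite ler0_norm; last lra.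
  have := ler_wpM2r y0 h2; rewrite h3.
  have := ler_wpM2l hx h1; rewrite expr2; lra.
have -> : (\prod_(i < m) (D - 2 * i))%N%:R = D%:R ^+ m * \prod_(i < m) a i.
  rewrite natr_prod /a prodf_div prodr_const card_ord mulrCA divff ?mulr1//.
  by rewrite expf_neq0.
have -> : expR (- ((m%:R ^+ 2 - m%:R) / D%:R)) = \prod_(i < m) b i.
  by rewrite /b -expR_sum sumrN -mulr_suml sum_double_ord.
rewrite -mulrBr normrM ger0_norm ?exprn_ge0// ler_wpM2l ?exprn_ge0//.
apply: (le_trans (norm_prodB_le _ a01 b01)).
have -> : 4 * m%:R ^+ 3 / D%:R ^+ 2 = \sum_(i < m) (2 * m%:R / D%:R) ^+ 2 :> R.
  by rewrite sumr_const card_ord -mulr_natl; field.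
apply: ler_sum => i _; apply: (le_trans (ab i)).
rewrite lerXn2r ?nnegrE ?divr_ge0 ?mulr_ge0//.
by rewrite ler_wpM2r ?invr_ge0 ?(ltW Dp)// natrM ler_wpM2l// ler_nat ltnW.
Qed.

(** Replacing [D] by the value [D0] that it has for equal color classes changes
    the exponent by [O(y + 1 / n)] when [y <= 1 / 2]. For [y > 1 / 2] both
    terms of the difference lie between [0] and [D ^ m], while the right hand
    side is at least [D ^ m]; otherwise [D] is at least [n ^ 2 / 4]. *)
Lemma falling_prod_near (b : R) : 0 <= b -> exists2 C, 0 <= C &
  forall (n m D : nat) (D0 y : R), (0 < n)%N -> (0 < m)%N -> m%:R <= b * n%:R ->
    n%:R ^+ 2 <= 2 * D0 -> 0 <= y -> D%:R = D0 * (1 - y) ->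
    `|(\prod_(i < m) (D - 2 * i))%N%:R - D%:R ^+ m * expR (- (m%:R ^+ 2 / D0))|
    <= D%:R ^+ m * (C * (y + n%:R^-1)).
Proof.
move=> b0; pose C := 2 + 4 * b ^+ 2 + 64 * b ^+ 3 + 4 * b.
have C2 : 2 <= C.
  have := mulr_ge0 (ler0n R 4) (sqr_ge0 b); have := exprn_ge0 3 b0.
  by rewrite /C; lra.
exists C; first by lra.
move=> n m D D0 y n0 m0 mb nD y0 eD.
have np : 0 < n%:R :> R by rewrite ltr0n.
have mp : 0 < m%:R :> R by rewrite ltr0n.
have n2p : 0 < n%:R ^+ 2 :> R by rewrite exprn_gt0.
have D0p : 0 < D0 by lra.
have ni0 : 0 <= n%:R^-1 :> R by rewrite invr_ge0.
have v0 : 0 <= m%:R ^+ 2 / D0 by rewrite divr_ge0 ?sqr_ge0// ltW.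
have DX0 : 0 <= D%:R ^+ m :> R by rewrite exprn_ge0.
have [y12|y12] := ltP (1 / 2) y.
  have h1 : (\prod_(i < m) (D - 2 * i))%N%:R <= D%:R ^+ m :> R.
    rewrite -natrX ler_nat -[X in (_ <= _ ^ X)%N]card_ord -prod_nat_const.
    by apply: leq_prod => i _; rewrite leq_subr.
  have h2 : 0 <= D%:R ^+ m * expR (- (m%:R ^+ 2 / D0)) <= D%:R ^+ m.
    by rewrite mulr_ge0 ?expR_ge0//= ler_piMr// expR_le1 oppr_le0.
  have h3 : 1 <= C * (y + n%:R^-1) by nra.
  have h4 := ler_wpM2l DX0 h3; rewrite mulr1 in h4.
  case/andP: h2 => h2 h2'; apply: le_trans h4.
  have h5 := ler0n R (\prod_(i < m) (D - 2 * i))%N.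
  by rewrite ler_norml; apply/andP; split; lra.
have D0D : D0 <= 2 * D%:R by rewrite eD; nra.
have nD4 : n%:R ^+ 2 <= 4 * D%:R :> R by lra.
have Dp : 0 < D%:R :> R by lra.
have D1 : (0 < D)%N by rewrite -(ltr0n R).
set v := m%:R ^+ 2 / D0 in v0 *; set u : R := (m%:R ^+ 2 - m%:R) / D%:R.
have u0 : 0 <= u.
  rewrite /u divr_ge0 ?(ltW Dp)// subr_ge0 expr2 ler_peMl ?(ltW mp)//.
  by rewrite ler1n.
have m2 : m%:R ^+ 2 <= b ^+ 2 * n%:R ^+ 2 :> R.
  by rewrite -exprMn lerXn2r ?nnegrE ?(ltW mp)// mulr_ge0// ltW.
have m3 : m%:R ^+ 3 <= b ^+ 3 * n%:R ^+ 3 :> R.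
  by rewrite -exprMn lerXn2r ?nnegrE ?(ltW mp)// mulr_ge0// ltW.
have uv : `|u - v| <= (4 * b ^+ 2) * y + (4 * b) * n%:R^-1.
  have e1 : v - m%:R ^+ 2 / D%:R = - (m%:R ^+ 2 / D%:R * y).
    by rewrite /v eD; field; rewrite -(_ : D%:R / D0 = 1 - y) ?eD;
       [rewrite mulf_neq0 ?invr_eq0 lt0r_neq0// -eD|field; exact: lt0r_neq0].
  have e2 : u - v = m%:R ^+ 2 / D%:R * y - m%:R / D%:R.
    by rewrite /u mulrBl; lra.
  have e3 : 0 <= m%:R ^+ 2 / D%:R :> R by rewrite divr_ge0 ?sqr_ge0 ?(ltW Dp).
  have e3' : m%:R ^+ 2 / D%:R <= 4 * b ^+ 2 :> R.
    rewrite ler_pdivrMr//.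
    have := ler_wpM2l (sqr_ge0 b) nD4; lra.
  have e4 : 0 <= m%:R / D%:R :> R by rewrite divr_ge0 ?(ltW Dp) ?(ltW mp).
  have e4' : m%:R / D%:R <= 4 * b * n%:R^-1 :> R.
    rewrite ler_pdivrMr//.
    rewrite -(ler_pM2r np); have -> : 4 * b * n%:R^-1 * D%:R * n%:R = b * (4 * D%:R).
      by field; exact: lt0r_neq0.
    apply: le_trans (ler_wpM2l b0 nD4); rewrite expr2 mulrA ler_wpM2r// ltW//.
  rewrite e2.
  have h1 := ler_wpM2r y0 e3'; have h2 := mulr_ge0 e3 y0.
  have h3 : 0 <= b ^+ 2 * y by rewrite mulr_ge0 ?sqr_ge0.
  have h4 : 0 <= b / n%:R by rewrite mulr_ge0.
  by rewrite ler_norml; apply/andP; split; lra.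
have s3 : 4 * m%:R ^+ 3 / D%:R ^+ 2 <= 64 * b ^+ 3 * n%:R^-1 :> R.
  rewrite ler_pdivrMr ?exprn_gt0// -(ler_pM2r np).
  have -> : 64 * b ^+ 3 / n%:R * D%:R ^+ 2 * n%:R = 4 * b ^+ 3 * (4 * D%:R) ^+ 2.
    by field; exact: lt0r_neq0.
  apply: (@le_trans _ _ (4 * b ^+ 3 * (n%:R ^+ 2) ^+ 2)).
    have := ler_wpM2r (ltW np) m3.
    have -> : 4 * b ^+ 3 * (n%:R ^+ 2) ^+ 2 = 4 * (b ^+ 3 * n%:R ^+ 3 * n%:R) by ring.
    lra.
  by rewrite ler_wpM2l ?mulr_ge0 ?exprn_ge0// lerXn2r ?nnegrE ?sqr_ge0//.
have h1 := falling_prod_expR m D1; rewrite -/u in h1.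
have h2 := expRN_lipschitz u0 v0.
set P := (\prod_(i < m) _)%N%:R in h1 *.
have -> : P - D%:R ^+ m * expR (- v) = (P - D%:R ^+ m * expR (- u))
   + D%:R ^+ m * (expR (- u) - expR (- v)) by ring.
apply: (le_trans (ler_normD _ _)); rewrite [X in _ + X]normrM (ger0_norm DX0).
apply: (le_trans (lerD h1 (ler_wpM2l DX0 (le_trans h2 uv)))).
rewrite -mulrDr ler_wpM2l//.
have h3 : 0 <= b ^+ 3 * y by rewrite mulr_ge0 ?exprn_ge0.
have h4 : 0 <= b * y by rewrite mulr_ge0.
have h5 : 0 <= b ^+ 2 / n%:R by rewrite mulr_ge0 ?sqr_ge0.
by rewrite /C; lra.
Qed.

End FallingProduct.

(** * Asymptotics *)

Section Asymptotics.
Variables (R : realType) (q : nat).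
Hypothesis q_ge2 : (2 <= q)%N.

Local Notation d := (q%:R - 1 : R).
Local Notation coloring n := {ffun 'I_n -> 'I_q}.

Let q_gt0 : (0 < q)%N. Proof. exact: ltnW. Qed.
Let qr_gt0 : 0 < q%:R :> R. Proof. by rewrite ltr0n. Qed.
Let d_ge1 : 1 <= d.
Proof. by have : 2 <= q%:R :> R; [rewrite ler_nat | lra]. Qed.
Let d_gt0 : 0 < d. Proof. by have := d_ge1; lra. Qed.
Let qr_neq0 : q%:R != 0 :> R. Proof. exact: lt0r_neq0. Qed.
Let d_neq0 : d != 0. Proof. exact: lt0r_neq0. Qed.

(** Pearson's chi-squared statistic of the color class sizes, divided by
    [n (q - 1)]. *)
Definition imbalance n (c : coloring n) : R :=
  q%:R / (d * n%:R ^+ 2) * sqn (walk (fun=> 0 : R) c).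

(** The number of bichromatic ordered pairs when all color classes have size
    [n / q]. *)
Definition balanced_pairs n : R := n%:R ^+ 2 * (1 - 1 / q%:R).

Definition limit_factor n m : R :=
  (1 + 2 / d * (m%:R / n%:R)) `^ (- (d / 2)).

Lemma nb_bichromaticE n (c : coloring n) : (0 < n)%N ->
  (nb_bichromatic c)%:R = balanced_pairs n * (1 - imbalance c).
Proof.
move=> n0; rewrite (nb_bichromatic_sqn R c q_gt0) /balanced_pairs /imbalance.
by field; rewrite d_neq0 qr_neq0 pnatr_eq0 -lt0n n0.
Qed.

Lemma balanced_pairs_ge n : n%:R ^+ 2 <= 2 * balanced_pairs n.
Proof.
rewrite /balanced_pairs; have h : 1 / q%:R <= 1 / 2 :> R.
  by rewrite !div1r lef_pV2 ?posrE// ler_nat.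
by have := ler_wpM2l (sqr_ge0 (n%:R : R)) h; lra.
Qed.

Lemma balanced_pairs_gt0 n : (0 < n)%N -> 0 < balanced_pairs n.
Proof.
move=> n0; have := balanced_pairs_ge n.
have : 0 < n%:R ^+ 2 :> R by rewrite exprn_gt0// ltr0n.
lra.
Qed.

Lemma imbalance_itv n (c : coloring n) : (0 < n)%N -> 0 <= imbalance c <= 1.
Proof.
move=> n0; apply/andP; split.
  rewrite /imbalance mulr_ge0//.
    by rewrite divr_ge0 ?(ltW qr_gt0)// mulr_ge0 ?(ltW d_gt0)// sqr_ge0.
  by apply: sumr_ge0 => i _; exact: sqr_ge0.
have := ler0n R (nb_bichromatic c); rewrite nb_bichromaticE//.
by rewrite pmulr_rge0 ?balanced_pairs_gt0// subr_ge0.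
Qed.

Lemma inv_sqrt_rate n : (0 < n)%N -> let e := (Num.sqrt n%:R)^-1 : R in
  [/\ 0 < e, e <= 1, e ^+ 2 = n%:R^-1 & n%:R^-1 <= e].
Proof.
move=> n0 e; have np : 0 < n%:R :> R by rewrite ltr0n.
have s1 : 1 <= Num.sqrt n%:R :> R.
  by rewrite -[leLHS]sqrtr1 ler_wsqrtr// ler1n.
have s0 : 0 < Num.sqrt n%:R :> R by lra.
have e1 : e <= 1 by rewrite /e invf_le1.
have e0 : 0 < e by rewrite /e invr_gt0.
have e2 : e ^+ 2 = n%:R^-1 by rewrite /e exprVn sqr_sqrtr// ltW.
by split => //; rewrite -e2 expr2 ler_piMl// ltW.
Qed.

(** The Laplace transform of Pearson's statistic, with a rate. *)
Lemma mean_expR_imbalance (b : R) : 0 <= b -> exists2 C, 0 <= C &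
  forall n m, (0 < n)%N -> m%:R <= b * n%:R ->
  `|(\sum_(c : coloring n) expR (- (m%:R * imbalance c))) / q%:R ^+ n
    - limit_factor n m| <= C / Num.sqrt n%:R.
Proof.
move=> b0; have [C C0 H] := walk_heat q_gt0 b0.
exists C => // n m n0 mb.
have np : 0 < n%:R :> R by rewrite ltr0n.
have nn0 : n%:R != 0 :> R by apply: lt0r_neq0.
have := inv_sqrt_rate n0; set e := (Num.sqrt n%:R)^-1 => -[e0 e1 e2 _].
(* With this [t], [heat t 0] at the end of the walk is
   [expR (- (m%:R * imbalance c))], and [t * n] is [m / (n (q - 1))]. *)
pose t : R := m%:R / (d * n%:R ^+ 2).
have t0 : 0 <= t by rewrite /t divr_ge0// mulr_ge0 ?(ltW d_gt0)// sqr_ge0.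
have tn : t * n%:R <= b.
  have -> : t * n%:R = m%:R / n%:R / d.
    by rewrite /t; field; rewrite d_neq0 nn0.
  rewrite ler_pdivrMr// ler_pdivrMr//; apply: (le_trans mb).
  by rewrite ler_wpM2r ?(ltW np)// ler_peMr.
have te : t <= b * e ^+ 2 by rewrite e2 ler_pdivlMr.
have x0 : \sum_(i < q) (fun=> 0 : R) i = 0 by rewrite big1.
have := H n e t (fun=> 0) e0 e1 t0 te x0.
have -> : n%:R * (C * e ^+ 3) = C / Num.sqrt n%:R.
  by rewrite exprS e2 -/e; field.
have -> : heat t n (fun _ : 'I_q => 0 : R) = limit_factor n m.
  rewrite /heat /limit_factor /powR.
  have -> : sqn (fun _ : 'I_q => 0 : R) = 0 :> R.
    by rewrite /sqn big1// => i _; rewrite expr0n.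
  have -> : 1 + 2 / d * (m%:R / n%:R) = 1 + 2 * (t * n%:R).
    by rewrite /t; field; rewrite d_neq0 nn0.
  rewrite ifF; last by apply/negbTE/lt0r_neq0; have := mulr_ge0 t0 (ltW np); lra.
  by congr expR; rewrite mulr0 mul0r subr0 mulNr.
under eq_bigr => c _.
  rewrite (_ : heat t 0 (walk (fun=> 0) c) = expR (- (m%:R * imbalance c))).
    over.
  rewrite /heat mulr0 mulr0 addr0 ln1 mulr0 oppr0 add0r divr1 /t /imbalance.
  by congr expR; field; rewrite d_neq0 nn0.
by apply => i; rewrite normr0 add0r.
Qed.

Lemma card_coloring n : #|{: coloring n}|%:R = q%:R ^+ n :> R.
Proof. by rewrite card_ffun !card_ord natrX. Qed.

Lemma mean_norm_le n (f : coloring n -> R) (B : R) :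
  (forall c, `|f c| <= B) -> `|(\sum_c f c) / q%:R ^+ n| <= B.
Proof.
move=> fB; have qn : 0 < q%:R ^+ n :> R by rewrite exprn_gt0.
rewrite normrM normfV (gtr0_norm qn) ler_pdivrMr//.
apply: (le_trans (ler_norm_sum _ _ _)).
rewrite -card_coloring mulr_natr -sumr_const.
by apply: ler_sum => c _; exact: fB.
Qed.

Section Window.
Variables (a b : R).
Hypothesis a_gt0 : 0 < a.

Lemma window_edges n m : (0 < n)%N -> a <= m%:R / n%:R <= b ->
  [/\ (0 < m)%N, m%:R <= b * n%:R & m%:R^-1 <= a^-1 / Num.sqrt n%:R :> R].
Proof.
move=> n0; have np : 0 < n%:R :> R by rewrite ltr0n.
rewrite ler_pdivlMr// ler_pdivrMr// => /andP[h1 h2].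
have an : 0 < a * n%:R by rewrite mulr_gt0.
have mp : 0 < m%:R :> R by lra.
split => //; first by rewrite -(ltr0n R).
have [_ _ _ h] := inv_sqrt_rate n0.
apply: (@le_trans _ _ (a * n%:R)^-1).
  by rewrite lef_pV2 ?posrE.
by rewrite invfM ler_wpM2l// invr_ge0 ltW.
Qed.

Lemma mean_exprn_imbalance : 0 <= b -> exists2 C, 0 <= C &
  forall n m, (0 < n)%N -> a <= m%:R / n%:R <= b ->
  `|(\sum_(c : coloring n) (1 - imbalance c) ^+ m) / q%:R ^+ n
    - limit_factor n m| <= C / Num.sqrt n%:R.
Proof.
move=> b0; have [C C0 H] := mean_expR_imbalance b0.
exists (4 / a + C); first by rewrite addr_ge0// divr_ge0// ltW.
move=> n m n0 abm; have [m0 mb mi] := window_edges n0 abm.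
have -> : (\sum_(c : coloring n) (1 - imbalance c) ^+ m) / q%:R ^+ n
    - limit_factor n m =
    ((\sum_(c : coloring n) expR (- (m%:R * imbalance c))) / q%:R ^+ n
    - limit_factor n m)
    - (\sum_(c : coloring n) (expR (- (m%:R * imbalance c))
          - (1 - imbalance c) ^+ m)) / q%:R ^+ n.
  by rewrite sumrB mulrBl; ring.
apply: (le_trans (ler_normB _ _)); rewrite [leRHS]mulrDl addrC.
apply: lerD; last exact: H.
apply: mean_norm_le => c.
have /andP[h1 h2] := expRN_exprn1B m0 (imbalance_itv c n0).
rewrite ger0_norm//; apply: (le_trans h2).
by rewrite -mulrA ler_wpM2l.
Qed.

(** The error [O(y + 1 / n)] of the pointwise estimate comes with the factor
    [(1 - y) ^+ m <= expR (- (m * y))], so that its mean is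
    [O(1 / m + 1 / n)]. *)
Lemma mean_falling_imbalance : 0 <= b -> exists2 C, 0 <= C &
  forall n m, (0 < n)%N -> a <= m%:R / n%:R <= b ->
  `|(\sum_(c : coloring n)
       (\prod_(i < m) (nb_bichromatic c - 2 * i))%N%:R / balanced_pairs n ^+ m)
       / q%:R ^+ n
    - limit_factor n m * expR (- (m%:R ^+ 2 / balanced_pairs n))|
  <= C / Num.sqrt n%:R.
Proof.
move=> b0; have [C C0 H] := mean_exprn_imbalance b0.
have [C' C'0 H'] := falling_prod_near b0.
exists (C' * (a^-1 + 1) + C).
  by rewrite addr_ge0// mulr_ge0// addr_ge0// invr_ge0 ltW.
move=> n m n0 abm; have [m0 mb mi] := window_edges n0 abm.
have [_ _ _ ni] := inv_sqrt_rate n0.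
have mp : 0 < m%:R :> R by rewrite ltr0n.
have D0 := balanced_pairs_gt0 n0.
have DX : 0 < balanced_pairs n ^+ m by rewrite exprn_gt0.
set k := expR _.
have k01 : 0 <= k <= 1.
  by rewrite /k expR_ge0 expR_le1 oppr_le0 divr_ge0 ?sqr_ge0// ltW.
pose P (c : coloring n) : R :=
  (\prod_(i < m) (nb_bichromatic c - 2 * i))%N%:R / balanced_pairs n ^+ m.
have -> : (\sum_c P c) / q%:R ^+ n - limit_factor n m * k =
   (\sum_c (P c - (1 - imbalance c) ^+ m * k)) / q%:R ^+ n
   + ((\sum_(c : coloring n) (1 - imbalance c) ^+ m) / q%:R ^+ n
    - limit_factor n m) * k.
  have E : \sum_(c : coloring n) (1 - imbalance c) ^+ m * k =
      (\sum_(c : coloring n) (1 - imbalance c) ^+ m) * k by rewrite mulr_suml.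
  by rewrite sumrB E; ring.
apply: (le_trans (ler_normD _ _)); rewrite [leRHS]mulrDl; apply: lerD; last first.
  rewrite normrM; case/andP: k01 => k0 k1; rewrite (ger0_norm k0).
  by apply: le_trans (H n m n0 abm); rewrite ler_piMr.
apply: mean_norm_le => c.
have /andP[y0 y1] := imbalance_itv c n0.
have := H' n m _ _ _ n0 m0 mb (balanced_pairs_ge n) y0 (nb_bichromaticE c n0).
rewrite -/k; set Q := (\prod_(i < m) _)%N%:R => h.
have DE : (nb_bichromatic c)%:R ^+ m =
    balanced_pairs n ^+ m * (1 - imbalance c) ^+ m.
  by rewrite nb_bichromaticE// exprMn.
have PE : P c - (1 - imbalance c) ^+ m * k =
    (Q - (nb_bichromatic c)%:R ^+ m * k) / balanced_pairs n ^+ m.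
  by rewrite /P DE -/Q; field; exact: lt0r_neq0.
rewrite PE normrM normfV (gtr0_norm DX) ler_pdivrMr//.
apply: (le_trans h); rewrite DE -mulrA [leRHS]mulrC ler_wpM2l ?(ltW DX)//.
have y2 : 0 <= (1 - imbalance c) ^+ m by rewrite exprn_ge0// subr_ge0.
have y3 : (1 - imbalance c) ^+ m <= 1 by rewrite exprn_ile1// ?subr_ge0// gerBl.
have y4 : (1 - imbalance c) ^+ m * imbalance c <= m%:R^-1.
  have /andP[h1 _] := expRN_exprn1B m0 (imbalance_itv c n0).
  have my0 : 0 <= m%:R * imbalance c := mulr_ge0 (ltW mp) y0.
  have h2 := mul_expRN_le1 my0.
  rewrite -(ler_pM2l mp) divff ?lt0r_neq0//; apply: le_trans h2.
  rewrite mulrCA [leRHS]mulrC (ler_wpM2r my0)//.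
  by move: h1; rewrite subr_ge0.
rewrite mulrCA -!mulrA ler_wpM2l//.
rewrite mulrDr mulrDl mul1r; apply: lerD; first exact: le_trans mi.
by apply: le_trans ni; rewrite ler_piMl// invr_ge0.
Qed.

End Window.

Lemma limit_factor_ge n m (b : R) : (0 < n)%N -> m%:R <= b * n%:R ->
  expR (- b) <= limit_factor n m.
Proof.
move=> n0 mb; have np : 0 < n%:R :> R by rewrite ltr0n.
set x : R := m%:R / n%:R; have x0 : 0 <= x by rewrite divr_ge0// ltW.
have xb : x <= b by rewrite /x ler_pdivrMr.
have y0 : 0 <= 2 / d * x by rewrite mulr_ge0// divr_ge0// ltW.
rewrite /limit_factor -/x /powR ifF; last by apply/negbTE/lt0r_neq0; lra.
rewrite ler_expR mulNr lerN2.
have h : ln (1 + 2 / d * x) <= 2 / d * x by apply: le_ln1Dx; lra.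
have d20 : 0 <= d / 2 by rewrite divr_ge0// ltW.
apply: le_trans (ler_wpM2l d20 h) _.
by have -> : d / 2 * (2 / d * x) = x by field.
Qed.

(** A factorization of both sides through a common non-negative factor turns
    an absolute error on bounded quantities into a relative one. *)
Lemma equiv_on_compacts_of_rate (f g : nat -> nat -> R) :
  (forall a b : R, 0 < a -> a <= b -> exists C l : R, [/\ 0 <= C, 0 < l &
     forall n m, (0 < n)%N -> a <= m%:R / n%:R <= b ->
     exists N M L : R, [/\ f n m = N * M, g n m = N * L, 0 <= N, l <= L &
       `|M - L| <= C / Num.sqrt n%:R]]) ->
  equiv_on_compacts f g.
Proof.
move=> H a b a0 ab eps eps0.
have [C [l [C0 l0 {}H]]] := H a b a0 ab.
have el : 0 < eps * l by rewrite mulr_gt0.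
near=> n => m abm.
have n0 : (0 < n)%N by near: n; exact: nbhs_infty_gt.
have [N [M [L [-> -> N0 lL ML]]]] := H n m n0 abm.
rewrite -mulrBr !normrM (ger0_norm N0) mulrCA ler_wpM2l//.
rewrite (ger0_norm (le_trans (ltW l0) lL)).
apply: (le_trans ML); apply: (@le_trans _ _ (eps * l)); last first.
  by rewrite ler_wpM2l// ltW.
have np : 0 < n%:R :> R by rewrite ltr0n.
have sp : 0 < Num.sqrt n%:R :> R by rewrite sqrtr_gt0.
rewrite ler_pdivrMr// -ler_pdivrMl// mulrC.
have Cel : 0 <= C / (eps * l) by rewrite divr_ge0// ltW.
rewrite -(ger0_norm Cel) -sqrtr_sqr ler_wsqrtr//.
by near: n; exact: nbhs_infty_ger.
Unshelve. all: by end_near.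
Qed.

Definition common_factor n m : R :=
  (2 ^ m * m`!)%:R^-1 * balanced_pairs n ^+ m * q%:R ^+ n.

Lemma common_factor_ge0 n m : (0 < n)%N -> 0 <= common_factor n m.
Proof.
by move=> n0; rewrite !mulr_ge0 ?invr_ge0 ?exprn_ge0// ltW// balanced_pairs_gt0.
Qed.

Lemma colored_asympE n m :
  colored_asymp R q n m = common_factor n m * limit_factor n m.
Proof.
rewrite /colored_asymp /common_factor -/(limit_factor n m).
by rewrite /balanced_pairs exprMn -exprM; ring.
Qed.

Lemma equiv_nb_colored :
  equiv_on_compacts (nb_colored R q) (colored_asymp R q).
Proof.
apply: equiv_on_compacts_of_rate => a b a0 ab.
have b0 : 0 <= b by lra.
have [C C0 H] := mean_exprn_imbalance a0 b0.
exists C, (expR (- b)); split=> [//||n m n0 abm]; first exact: expR_gt0.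
have [_ mb _] := window_edges a0 n0 abm.
exists (common_factor n m),
  ((\sum_(c : coloring n) (1 - imbalance c) ^+ m) / q%:R ^+ n), (limit_factor n m).
split; [|exact: colored_asympE|exact: common_factor_ge0
        |exact: limit_factor_ge|exact: H].
rewrite nb_coloredE /common_factor.
under eq_bigr do rewrite nb_bichromaticE// exprMn.
rewrite -mulr_sumr; field.
by rewrite expf_neq0//= !pnatr_eq0 -!lt0n expn_gt0 fact_gt0.
Qed.

Lemma equiv_nb_colored_simple :
  equiv_on_compacts (nb_colored_simple R q) (colored_simple_asymp R q).
Proof.
apply: equiv_on_compacts_of_rate => a b a0 ab.
have b0 : 0 <= b by lra.
have [C C0 H] := mean_falling_imbalance a0 b0.
exists C, (expR (- b) * expR (- (2 * b ^+ 2))).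
split=> [//||n m n0 abm]; first by rewrite mulr_gt0 ?expR_gt0.
have [_ mb _] := window_edges a0 n0 abm.
have np : 0 < n%:R :> R by rewrite ltr0n.
have nn : n%:R != 0 :> R by apply: lt0r_neq0.
have D0 := balanced_pairs_gt0 n0.
exists (common_factor n m); do 2!eexists.
split; last exact: (H n m n0 abm).
- rewrite nb_colored_simpleE /common_factor -mulr_suml; field.
  by rewrite !expf_neq0 ?lt0r_neq0//= !pnatr_eq0 -!lt0n expn_gt0 fact_gt0.
- rewrite /colored_simple_asymp colored_asympE -[LHS]mulrA.
  congr (_ * (_ * expR (- _))).
  by rewrite /balanced_pairs; field; rewrite d_neq0 nn qr_neq0.
- exact: common_factor_ge0.
rewrite ler_pM ?expR_ge0 ?limit_factor_ge// ler_expR lerN2.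
rewrite ler_pdivrMr//.
have h1 : m%:R ^+ 2 <= b ^+ 2 * n%:R ^+ 2 :> R.
  by rewrite -exprMn lerXn2r ?nnegrE// mulr_ge0// ltW.
have := ler_wpM2l (sqr_ge0 b) (balanced_pairs_ge n).
lra.
Qed.

End Asymptotics.

Theorem mainTheorem9 (R : realType) (q : nat) :
  (forall n m : nat, nb_colored R q n m = nb_typed (Rcol R q) n m) /\
  ((2 <= q)%N ->
     equiv_on_compacts (nb_colored R q) (colored_asymp R q) /\
     equiv_on_compacts (nb_colored_simple R q) (colored_simple_asymp R q)).
Proof.
split=> [n m|q2]; first exact: nb_colored_typed.
split; [exact: equiv_nb_colored | exact: equiv_nb_colored_simple].
Qed.
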